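(* Let $q$ be a power of an odd prime, $j\in\mathbb F_q^*$, $S_j=\{x\in\mathbb F_q^d: x_1^2+\cdots+x_d^2=j\}$, $A\subset S_j$ and $B\subset\mathbb F_q^d$. (i) If $j$ is a square in $\mathbb F_q^*$, $d=4k-1$ with $k$ a positive integer, $q\equiv3\pmod4$, and $|A||B|\ge4q^d$, then $|\Delta(A,B)|\ge q/4$. (ii) If $j$ is a non-square in $\mathbb F_q^*$, either $d=4k+1$ ($k$ a positive integer) or ($d=4k-1$ and $q\equiv1\pmod4$), and $|A||B|\ge4q^d$, then $|\Delta(A,B)|\ge q/4$.
   Context: $\|x-y\|=\sum_{i}(x_i-y_i)^2$ and $\Delta(A,B)=\{\|a-b\|:a\in A,b\in B\}$. *)

(* Defs.v *)
From mathcomp Require Import all_boot all_order all_algebra all_field.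
Set Implicit Arguments. Unset Strict Implicit. Unset Printing Implicit Defensive.
Import GRing.Theory.
Local Open Scope ring_scope.

Definition vec (F : finFieldType) (d : nat) := {ffun 'I_d -> F}.

Definition dist (F : finFieldType) (d : nat) (x y : vec F d) : F :=
  \sum_(i < d) (x i - y i) ^+ 2.

Definition sphere (F : finFieldType) (d : nat) (j : F) : {set vec F d} :=
  [set x : vec F d | \sum_(i < d) (x i) ^+ 2 == j].

Definition distset (F : finFieldType) (d : nat) (A B : {set vec F d}) : {set F} :=
  [set dist a b | a in A, b in B].

Definition is_square (F : finFieldType) (j : F) : Prop := exists t : F, j = t ^+ 2.

(* Main.v *)
(* Over an odd-dimensional space, d = 2m+1, quadratic Gauss sums count exactly the
   points of a sphere {||x|| = t} and of its section by a hyperplane {x.v = c}.  The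
   arithmetic hypotheses all say that chi((-1)^m j) = -1, chi being the quadratic
   character: S_j is then small, and none of its hyperplane sections exceeds the
   expected q^(d-2) by more than q^(m-1).
   If |A| >= q^m, sum over all a in S_j the variance of the number of b in B at distance t
   from a; its second moment counts triples (a, b, b') with ||a-b|| = ||a-b'||, that is,
   points on sections of S_j.  If |A| <= q^m, sum over all x in F^d the squared deviation of
   the number of a in A with ||a-x|| in Delta(A, B), which equals |A| whenever x is in B;
   here the second moment counts the points of intersections of two spheres. *)
Require Import Defs.
From mathcomp Require Import all_boot all_order all_algebra all_field.
From mathcomp Require Import all_fingroup all_character zify ring lra.
Set Implicit Arguments. Unset Strict Implicit. Unset Printing Implicit Defensive.
Import Order.TTheory GRing.Theory Num.Theory.
Local Open Scope ring_scope.

(** * Additive characters of a finite field *)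

Definition additive_char (F : finFieldType) (psi : F -> algC) : Prop :=
  [/\ psi 0 = 1, forall x y, psi (x + y) = psi x * psi y & exists x, psi x != 1].

(** An abelian group has as many irreducible characters as elements, hence a nontrivial one; being
    linear, it turns sums into products. *)
Lemma additive_char_exists (F : finFieldType) : exists psi : F -> algC, additive_char psi.
Proof.
have abF : abelian [set: F] by apply/centsP => x _ y _; rewrite /commute !FinRing.zmodMgE addrC.
have nirr : (1 < Nirr [set: F])%N.
  have := NirrE [set: F]; rewrite (_ : #|classes _| = #|F|) => [->|].
    exact: finNzRing_gt1.
  by move: abF; rewrite card_classes_abelian cardsT => /eqP.
pose i : Iirr [set: F] := Ordinal nirr.
have lin_i : 'chi_i \is a linear_char by move/char_abelianP: abF; apply.
exists 'chi_i; split.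
- exact: lin_char1.
- by move=> x y; have := lin_charM lin_i (in_setT x) (in_setT y); rewrite FinRing.zmodMgE.
apply/existsP; apply: contraT; rewrite negb_exists => /forallP h.
have : 'chi_i = 1 :> 'CF([set: F]).
  by apply/cfunP => x; rewrite cfun1E inE; have := h x; rewrite negbK => /eqP.
by move/eqP; rewrite -irr0 (inj_eq irr_inj).
Qed.

(** * The quadratic character *)

Definition nb_sqrt (F : finFieldType) (z : F) : nat := #|[set x : F | x ^+ 2 == z]|.

(** In odd characteristic this takes the values 1, 0, -1 on nonzero squares, zero and non-squares.
    Defined through root counts, it appears directly when a sum over [x ^+ 2] is regrouped by
    value. *)
Definition quad_char (F : finFieldType) (z : F) : int := (nb_sqrt z)%:Z - 1.

Section QuadraticCharacter.
Variable F : finFieldType.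
Hypothesis two_neq0 : (2 : F) != 0.
Implicit Types w z t : F.

Lemma nb_sqrt0 : nb_sqrt (0 : F) = 1%N.
Proof.
rewrite -[RHS](cards1 (0 : F)).
by apply: eq_card => x; rewrite !inE sqrf_eq0.
Qed.

Lemma nb_sqrt_sqr t : t != 0 -> nb_sqrt (t ^+ 2) = 2.
Proof.
move=> t0; have tNt : t != - t by rewrite -subr_eq0 opprK -mulr2n -mulr_natl mulf_neq0.
rewrite -[RHS](_ : #|[set t; - t]| = 2); last by rewrite cards2 tNt.
by apply: eq_card => x; rewrite !inE eqf_sqr.
Qed.

Lemma nb_sqrt_nonsquare z : ~ is_square z -> nb_sqrt z = 0%N.
Proof.
move=> nsq; apply/eqP; rewrite cards_eq0; apply/eqP/setP => x; rewrite !inE.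
by apply/negP => /eqP xz; apply: nsq; exists x.
Qed.

Lemma is_squareP z : is_square z \/ ~ is_square z.
Proof.
have [/existsP[t /eqP zt]|/existsPn h] := boolP [exists t, z == t ^+ 2].
  by left; exists t.
by right=> -[t zt]; have := h t; rewrite zt eqxx.
Qed.

Lemma nb_sqrt_le2 z : (nb_sqrt z <= 2)%N.
Proof.
have [[t ->]|/nb_sqrt_nonsquare->//] := is_squareP z.
by have [->|/nb_sqrt_sqr->//] := eqVneq t 0; rewrite expr0n /= nb_sqrt0.
Qed.

Lemma quad_char_square z : z != 0 -> is_square z -> quad_char z = 1.
Proof.
by move=> z0 [t zt]; rewrite /quad_char zt nb_sqrt_sqr //; move: z0; rewrite zt sqrf_eq0.
Qed.

Lemma quad_char_nonsquare z : ~ is_square z -> quad_char z = -1.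
Proof. by move=> /nb_sqrt_nonsquare h; rewrite /quad_char h. Qed.

Lemma norm_quad_char z : z != 0 -> `|quad_char z| = 1.
Proof.
move=> z0; have [h|/quad_char_nonsquare->//] := is_squareP z.
by rewrite quad_char_square.
Qed.

Lemma norm_quad_char_le z : `|quad_char z| <= 1.
Proof. by rewrite /quad_char; case: (nb_sqrt z) (nb_sqrt_le2 z) => [|[|[]]]. Qed.

(** A product that is a nonzero square forces both factors into the same square class. *)
Lemma quad_char_eq w z c :
  w != 0 -> z != 0 -> c ^+ 2 = z * w -> quad_char w = quad_char z.
Proof.
move=> w0 z0 czw; have c0 : c != 0 by rewrite -sqrf_eq0 czw mulf_neq0.
have wE : w = c ^+ 2 / z by rewrite czw mulrAC divff // mul1r.
have zE : z = c ^+ 2 / w by rewrite czw mulfK.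
have [[t zt]|nz] := is_squareP z.
  rewrite !quad_char_square //; first by exists t.
  by exists (c / t); rewrite wE zt exprMn exprVn.
rewrite !quad_char_nonsquare // => -[t wt]; apply: nz.
by exists (c / t); rewrite zE wt exprMn exprVn.
Qed.

Lemma sum_nb_sqrt : (\sum_(z : F) nb_sqrt z = #|F|)%N.
Proof.
rewrite -[RHS]sum1_card [RHS](partition_big (fun x : F => x ^+ 2) xpredT) //=.
apply: eq_bigr => z _; rewrite /nb_sqrt -[LHS]sum1_card.
by apply: eq_bigl => x; rewrite !inE.
Qed.

Lemma quad_charM_nonsquare w z :
  ~ is_square w -> quad_char (w * z) = - quad_char z.
Proof.
move=> nw; have w0 : w != 0 by apply/eqP => w0; apply: nw; exists 0; rewrite w0 expr0n.
(* [w z] and [z] are never both nonzero squares, and on average they have one square root each. *)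
have le2 y : (nb_sqrt (w * y)%R + nb_sqrt y <= 2)%N.
  have [[t yt]|/nb_sqrt_nonsquare->] := is_squareP y; last by rewrite addn0 nb_sqrt_le2.
  have [y0|y0] := eqVneq y 0; first by rewrite y0 mulr0 nb_sqrt0.
  have t0 : t != 0 by move: y0; rewrite yt sqrf_eq0.
  rewrite (nb_sqrt_nonsquare (z := w * y)) ?nb_sqrt_le2 // => -[u wy]; apply: nw.
  by exists (u / t); rewrite exprMn exprVn -wy yt mulfK // sqrf_eq0.
have eq2 : (\sum_(y : F) (nb_sqrt (w * y)%R + nb_sqrt y) = \sum_(y : F) 2)%N.
  rewrite big_split /= sum_nb_sqrt sum_nat_const muln2 -addnn; congr addn.
  by rewrite -{1}sum_nb_sqrt [RHS](reindex_inj (mulfI w0)).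
suff : (nb_sqrt (w * z)%R + nb_sqrt z = 2)%N.
  by rewrite /quad_char; lia.
apply/eqP; rewrite eqn_leq le2 /= leqNgt; apply/negP => lt2.
suff : (\sum_(y : F) (nb_sqrt (w * y)%R + nb_sqrt y) < \sum_(y : F) 2)%N by rewrite eq2 ltnn.
rewrite (bigD1 z) // [ltnRHS](bigD1 z) //= -addSn leq_add //.
by apply: leq_sum => y _; apply: le2.
Qed.

(** With q = 4n+1, the equation y^(2n) = 1 has at most 2n roots among the 4n nonzero elements. Some
    y therefore has y^(2n) = -1, and y^n is a square root of -1. *)
Lemma quad_charN1_1mod4 : (#|F| %% 4 = 1)%N -> quad_char (-1 : F) = 1.
Proof.
move=> q1; set n := (#|F| %/ 4)%N; have qE : #|F| = (n * 4).+1.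
  by rewrite {1}(divn_eq #|F| 4) q1 addn1.
have n_gt0 : (0 < n)%N by have := finNzRing_gt1 F; rewrite qE; case: (n).
have [y /andP[y0 yn]] : exists y : F, (y != 0) && (y ^+ (n * 2) != 1).
  apply/existsP; apply: contraT => /existsPn h.
  have := @max_unity_roots F (n * 2) (enum (predC1 (0 : F))).
  rewrite enum_uniq -cardE cardC1 qE /= muln_gt0 n_gt0 leq_pmul2l // => roots_le.
  apply: roots_le => //.
  apply/allP => x; rewrite mem_enum inE => x0.
  by have := h x; rewrite x0 /= negbK => ?; apply/unity_rootP/eqP.
have : (y ^+ (n * 2)) ^+ 2 == 1.
  rewrite -exprM -mulnA -(inj_eq (mulfI y0)) -exprS -qE expf_card mulr1 //.
rewrite sqrf_eq1 (negPf yn) /= => /eqP ynN1.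
apply: quad_char_square; first by rewrite oppr_eq0 oner_neq0.
by exists (y ^+ n); rewrite -exprM.
Qed.

(** If t^2 = -1, then t^(q-1) is an odd power of -1 because (q-1)/2 is odd; so t^q = -t, against t^q
    = t. *)
Lemma quad_charN1_3mod4 : (#|F| %% 4 = 3)%N -> quad_char (-1 : F) = -1.
Proof.
move=> q3; apply: quad_char_nonsquare => -[t tt].
have t0 : t != 0 by rewrite -sqrf_eq0 -tt oppr_eq0 oner_neq0.
have := expf_card t; have -> : #|F| = (((#|F| %/ 4).*2.+1).*2).+1.
  by rewrite {1}(divn_eq #|F| 4) q3; lia.
rewrite exprS -muln2 mulnC exprM -tt exprS -muln2 mulnC exprM sqrrN expr1n expr1n.
rewrite mulr1 mulrN1 => /eqP; rewrite -subr_eq0 -opprD oppr_eq0 -mulr2n -mulr_natl.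
by rewrite mulf_eq0 (negPf two_neq0) (negPf t0).
Qed.

End QuadraticCharacter.

(** * Quadratic Gauss sums *)

Definition gauss_sum (F : finFieldType) (psi : F -> algC) (s : F) : algC :=
  \sum_x psi (s * x ^+ 2).

Section GaussSums.
Variables (F : finFieldType) (psi : F -> algC).
Hypothesis two_neq0 : (2 : F) != 0.
Hypothesis psi_char : additive_char psi.
Local Notation q := (#|F|%:R : algC).
Local Notation G := (gauss_sum psi).
Implicit Types s t u w x y z : F.

Let psi0 : psi 0 = 1. Proof. by case: psi_char. Qed.
Let psiD x y : psi (x + y) = psi x * psi y. Proof. by case: psi_char. Qed.

Lemma additive_char_sum (I : Type) (r : seq I) (P : pred I) (f : I -> F) :
  psi (\sum_(i <- r | P i) f i) = \prod_(i <- r | P i) psi (f i).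
Proof. exact: (big_morph psi psiD psi0). Qed.

Lemma sum_additive_char a : \sum_x psi (a * x) = (a == 0)%:R * q.
Proof.
have [->|a0] := eqVneq a 0.
  under eq_bigr do rewrite mul0r psi0.
  by rewrite sumr_const mul1r.
have [_ _ [y psiy]] := psi_char.
rewrite mul0r; apply/eqP; set S := \sum_x _.
have : (psi y - 1) * S == 0.
  rewrite mulrBl mul1r subr_eq0 mulr_sumr /S [eqbRHS](reindex_inj (addrI (a^-1 * y))).
  by apply/eqP/eq_bigr => x _; rewrite mulrDr mulVKf // psiD.
by rewrite mulf_eq0 subr_eq0 (negPf psiy).
Qed.

Lemma gauss_sum0 : G 0 = q.
Proof.
by rewrite /gauss_sum; under eq_bigr do rewrite mul0r psi0; rewrite sumr_const.
Qed.

(** Putting x = y + z turns s(x^2 - y^2) into s z^2 + 2 s z y, which is linear in y: only z = 0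
    survives the sum over y. *)
Lemma gauss_sum_mulN s : s != 0 -> G s * G (- s) = q.
Proof.
move=> s0; rewrite /gauss_sum mulr_suml.
under eq_bigr => x _ do rewrite mulr_sumr.
rewrite exchange_big /=.
under eq_bigr => y _ do rewrite (reindex_inj (addrI y)) /=.
rewrite exchange_big /= (bigD1 0) //= [X in _ + X]big1 ?addr0.
  rewrite (eq_bigr (fun=> 1)) ?sumr_const // => y _.
  by rewrite addr0 -psiD mulNr subrr psi0.
move=> z z0; rewrite (eq_bigr (fun y => psi (s * z ^+ 2) * psi (2 * s * z * y))) => [|y _].
  by rewrite -mulr_sumr sum_additive_char !mulf_eq0 (negPf s0)
             (negPf z0) (negPf two_neq0) mul0r mulr0.
by rewrite -!psiD; congr psi; ring.
Qed.

Lemma sum_comp_sqr (f : F -> algC) : \sum_x f (x ^+ 2) = \sum_z f z *+ nb_sqrt z.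
Proof.
rewrite (partition_big (fun x : F => x ^+ 2) xpredT) //=.
apply: eq_bigr => z _; rewrite (eq_bigr (fun=> f z)) => [|x /eqP->//].
by rewrite sumr_const; congr (_ *+ _); apply: eq_card => x; rewrite !inE.
Qed.

Lemma gauss_sumE s : s != 0 -> G s = \sum_z psi (s * z) * (quad_char z)%:~R.
Proof.
move=> s0; rewrite /gauss_sum (sum_comp_sqr (fun z => psi (s * z))).
rewrite -[LHS]subr0 -[X in _ - X](_ : \sum_z psi (s * z) = 0); last first.
  by rewrite sum_additive_char (negPf s0) mul0r.
rewrite -sumrB; apply: eq_bigr => z _.
by rewrite /quad_char rmorphB /= mulrBr mulr1 mulr_natr.
Qed.

Lemma gauss_sum_nonsquare s w : s != 0 -> ~ is_square w -> G (w * s) = - G s.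
Proof.
move=> s0 nw.
have w0 : w != 0 by apply/eqP => w0; apply: nw; exists 0; rewrite w0 expr0n.
rewrite !gauss_sumE ?mulf_neq0 // [X in - X](reindex_inj (mulfI w0)) -sumrN.
apply: eq_bigr => z _; rewrite quad_charM_nonsquare // rmorphN mulrN opprK.
by congr (psi _ * _); ring.
Qed.

Lemma gauss_sum_square s t : t != 0 -> G (s * t ^+ 2) = G s.
Proof.
move=> t0; rewrite [RHS](reindex_inj (mulfI t0)).
by rewrite /gauss_sum; apply: eq_bigr => x _; congr psi; ring.
Qed.

(** Multiplying the argument by a nonzero square preserves a Gauss sum and by a non-square negates
    it, so both cases reduce to [gauss_sum_mulN]. *)
Lemma gauss_sum_twist s w : s != 0 -> w != 0 ->
  G s * G (- (w * s)) = (quad_char w)%:~R * q.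
Proof.
move=> s0 w0; have [[t wt]|nw] := is_squareP w.
  rewrite quad_char_square //; last by exists t.
  rewrite wt -mulrN [_ ^+ 2 * _]mulrC gauss_sum_square ?gauss_sum_mulN ?mul1r //.
  by rewrite -sqrf_eq0 -wt.
rewrite quad_char_nonsquare // -mulrN gauss_sum_nonsquare ?oppr_eq0 //.
by rewrite mulrN gauss_sum_mulN // mulN1r.
Qed.

Lemma gauss_sum_sqr s : s != 0 -> G s ^+ 2 = (quad_char (-1 : F))%:~R * q.
Proof.
by move=> s0; rewrite -(gauss_sum_twist s0) ?oppr_eq0 ?oner_neq0 // mulN1r opprK.
Qed.

(** Completing the square: the shift of x by -u/(2s) removes the linear term. *)
Lemma sum_quadratic s u : s != 0 ->
  \sum_x psi (s * x ^+ 2 + u * x) = psi (- (u ^+ 2 / (4 * s))) * G s.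
Proof.
move=> s0; have s2 : 2 * s != 0 by rewrite mulf_neq0.
rewrite mulr_sumr (reindex_inj (addIr (- (u / (2 * s))))); apply: eq_bigr => x _.
rewrite -psiD; congr psi; field.
by rewrite s0 two_neq0 (natrM F 2 2) mulf_neq0.
Qed.

(** Summing over all s, orthogonality selects the x with x^2 = t and gives [nb_sqrt t] times q.
    Removing s = 0, which contributes q, leaves the quadratic character. *)
Lemma sum_gauss_sum t : \sum_(s | s != 0) G s * psi (- (s * t)) = (quad_char t)%:~R * q.
Proof.
have : \sum_s G s * psi (- (s * t)) = (nb_sqrt t)%:R * q.
  under eq_bigr => s _ do rewrite mulr_suml.
  rewrite exchange_big /=.
  rewrite (eq_bigr (fun x : F => ((x ^+ 2 == t)%:R * q))) => [|x _].
    rewrite -mulr_suml; congr (_ * _).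
    rewrite (sum_comp_sqr (fun z => (z == t)%:R)) (bigD1 t) //= eqxx big1 ?addr0 // => z /negPf->.
    by rewrite mul0rn.
  rewrite -subr_eq0 -sum_additive_char; apply: eq_bigr => s _.
  by rewrite -psiD; congr psi; ring.
rewrite (bigD1 0) //= gauss_sum0 mul0r oppr0 psi0 mulr1 /quad_char.
by rewrite rmorphB /= mulrBl mul1r => <-; rewrite [RHS]addrC addKr.
Qed.

End GaussSums.

(** * Character sum counts of spheres and their hyperplane sections *)

Definition sqnorm (F : finFieldType) (d : nat) (x : vec F d) : F := \sum_(i < d) x i ^+ 2.

Definition dot (F : finFieldType) (d : nat) (x y : vec F d) : F := \sum_(i < d) x i * y i.

Definition sphere_section (F : finFieldType) (d : nat) (t c : F) (v : vec F d) : {set vec F d} :=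
  [set x in sphere d t | dot x v == c].

Section Counting.
Variables (F : finFieldType) (psi : F -> algC).
Hypothesis two_neq0 : (2 : F) != 0.
Hypothesis psi_char : additive_char psi.
Local Notation q := (#|F|%:R : algC).
Local Notation G := (gauss_sum psi).
Implicit Types (s t u w c : F) (m d : nat).

Let psi0 : psi 0 = 1. Proof. by case: psi_char. Qed.
Let psiD x y : psi (x + y) = psi x * psi y. Proof. by case: psi_char. Qed.

Lemma sum_vec_prod d s u (v : vec F d) :
  \sum_(x : vec F d) psi (s * sqnorm x + u * dot x v) =
  \prod_(i < d) \sum_y psi (s * y ^+ 2 + u * v i * y).
Proof.
rewrite bigA_distr_bigA; apply: eq_bigr => x _.
rewrite /sqnorm /dot !mulr_sumr -big_split (additive_char_sum psi_char).
by apply: eq_bigr => i _; congr psi; rewrite /=; ring.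
Qed.

Lemma sum_vec_quadratic d s u (v : vec F d) : s != 0 ->
  \sum_(x : vec F d) psi (s * sqnorm x + u * dot x v) =
  psi (- (u ^+ 2 * sqnorm v / (4 * s))) * G s ^+ d.
Proof.
move=> s0; rewrite sum_vec_prod.
under eq_bigr => i _ do rewrite (sum_quadratic two_neq0 psi_char _ s0).
rewrite big_split /= prodr_const card_ord -(additive_char_sum psi_char) sumrN.
congr (psi (- _) * _); rewrite /sqnorm mulr_sumr mulr_suml.
by apply: eq_bigr => i _; rewrite exprMn.
Qed.

Lemma sum_vec_linear d u (v : vec F d) : v != 0 ->
  \sum_(x : vec F d) psi (u * dot x v) = (u == 0)%:R * q ^+ d.
Proof.
move=> v0; rewrite (eq_bigr (fun x => psi (0 * sqnorm x + u * dot x v))); last first.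
  by move=> x _; rewrite mul0r add0r.
rewrite sum_vec_prod; have [->|u0] := eqVneq u 0.
  rewrite (eq_bigr (fun=> q)) ?prodr_const ?card_ord ?mul1r // => i _.
  by rewrite (eq_bigr (fun=> 1)) ?sumr_const // => y _; rewrite !mul0r addr0 psi0.
have [i vi] : exists i, v i != 0.
  apply/existsP; apply: contraNT v0 => /existsPn h.
  by apply/eqP/ffunP => i; rewrite ffunE; apply/eqP; have := h i; rewrite negbK.
rewrite (bigD1 i) //= (eq_bigr (fun y => psi (u * v i * y))) => [|y _].
  by rewrite (sum_additive_char psi_char) mulf_eq0 (negPf u0) (negPf vi) !mul0r.
by rewrite mul0r add0r.
Qed.

(** Odd dimension enters here: the Gauss sums pair off into squares and exactly one is left over. *)
Lemma gauss_sum_odd_expr s m : s != 0 ->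
  G s ^+ (m.*2.+1) = ((quad_char (-1 : F))%:~R * q) ^+ m * G s.
Proof.
by move=> s0; rewrite exprSr -mul2n exprM (gauss_sum_sqr two_neq0 psi_char s0).
Qed.

(** The condition [sqnorm x = t] is detected by summing psi(s(|x| - t)) over s. The term s = 0 is
    the main one, and the others are evaluated by [sum_gauss_sum]. *)
Lemma sphere_count_char m t :
  #|sphere m.*2.+1 t|%:R * q =
  q ^+ m.*2.+1 + ((quad_char (-1 : F))%:~R * q) ^+ m * ((quad_char t)%:~R * q).
Proof.
transitivity (\sum_s \sum_(x : vec F m.*2.+1) psi (s * sqnorm x - s * t)).
  rewrite exchange_big /= -sum1_card natr_sum mulr_suml big_mkcond /=.
  apply: eq_bigr => x _.
  rewrite (eq_bigr (fun s => psi ((sqnorm x - t) * s))) => [|s _]; last by congr psi; ring.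
  by rewrite (sum_additive_char psi_char) subr_eq0 inE /sqnorm; case: eqP; rewrite ?mul0r ?mul1r.
rewrite (bigD1 0) //=; congr (_ + _).
  rewrite (eq_bigr (fun=> 1)) => [|x _]; last by rewrite !mul0r subr0.
  by rewrite sumr_const card_ffun card_ord natrX.
rewrite -(sum_gauss_sum psi_char t) mulr_sumr; apply: eq_bigr => s s0.
rewrite (eq_bigr (fun x : vec F m.*2.+1 => psi (s * sqnorm x + 0 * dot x 0) * psi (- (s * t)))).
  rewrite -mulr_suml sum_vec_quadratic // expr0n /= !mul0r oppr0 psi0 mul1r.
  by rewrite gauss_sum_odd_expr // mulrA.
by move=> x _; rewrite mul0r addr0 psiD.
Qed.

(** Two frequencies s and u detect the sphere and the hyperplane. For s = 0 only u = 0 contributes,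
    as v is nonzero; for s nonzero the sum over x is Gaussian. *)
Lemma section_count_expand m t c (v : vec F m.*2.+1) : v != 0 ->
  #|sphere_section t c v|%:R * q ^+ 2 =
  q ^+ m.*2.+1 + \sum_(s | s != 0) G s ^+ m.*2.+1 * psi (- (s * t)) *
     \sum_u psi (- (sqnorm v / (4 * s)) * u ^+ 2 + (- c) * u).
Proof.
move=> v0.
transitivity (\sum_s \sum_u \sum_(x : vec F m.*2.+1)
    psi ((sqnorm x - t) * s + (dot x v - c) * u)).
  under eq_bigr => s _ do rewrite exchange_big.
  rewrite exchange_big /= -sum1_card natr_sum mulr_suml big_mkcond /=.
  apply: eq_bigr => x _.
  rewrite (eq_bigr (fun s => psi ((sqnorm x - t) * s) * ((dot x v == c)%:R * q))).
    rewrite -mulr_suml (sum_additive_char psi_char) subr_eq0 !inE /sqnorm.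
    by do 2!case: eqP => _ /=; rewrite ?mul0r ?mulr0 ?mul1r ?expr2.
  move=> s _; rewrite -subr_eq0 -(sum_additive_char psi_char) mulr_sumr.
  by apply: eq_bigr => u _; rewrite psiD.
rewrite (bigD1 0) //=; congr (_ + _).
  rewrite (bigD1 0) //= [X in _ + X]big1 ?addr0 => [|u u0].
    rewrite (eq_bigr (fun=> 1)) => [|x _]; last by rewrite !mulr0 addr0.
    by rewrite sumr_const card_ffun card_ord natrX.
  rewrite (eq_bigr (fun x => psi (u * dot x v) * psi (- c * u))) => [|x _].
    by rewrite -mulr_suml sum_vec_linear // (negPf u0) !mul0r.
  by rewrite -psiD; congr psi; ring.
apply: eq_bigr => s s0; rewrite mulr_sumr; apply: eq_bigr => u _.
rewrite (eq_bigr (fun x => psi (s * sqnorm x + u * dot x v) * psi (- (s * t) - c * u))).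
  rewrite -mulr_suml sum_vec_quadratic //.
  have -> : - (sqnorm v / (4 * s)) * u ^+ 2 + - c * u =
            - (u ^+ 2 * sqnorm v / (4 * s)) + - (c * u).
    by field; rewrite s0 (natrM F 2 2) mulf_neq0.
  by rewrite !psiD; ring.
by move=> x _; rewrite -psiD; congr psi; ring.
Qed.

(** The quadratic term in u disappears, so the sum over u is q or 0 according to whether c = 0, and
    the leftover Gauss sum is handled as for the sphere. *)
Lemma section_count_isotropic_char m t c (v : vec F m.*2.+1) : v != 0 -> sqnorm v = 0 ->
  #|sphere_section t c v|%:R * q ^+ 2 =
  q ^+ m.*2.+1 + (c == 0)%:R * ((quad_char (-1 : F))%:~R * q) ^+ m * (quad_char t)%:~R * q ^+ 2.
Proof.
move=> v0 vv; rewrite section_count_expand // vv; congr (_ + _).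
transitivity (\sum_(s | s != 0) (c == 0)%:R * ((quad_char (-1 : F))%:~R * q) ^+ m * q *
                (G s * psi (- (s * t)))).
  apply: eq_bigr => s s0; rewrite gauss_sum_odd_expr //.
  rewrite (eq_bigr (fun u => psi (- c * u))) => [|u _]; last by rewrite mul0r oppr0 mul0r add0r.
  by rewrite (sum_additive_char psi_char) oppr_eq0; ring.
by rewrite -mulr_sumr (sum_gauss_sum psi_char); ring.
Qed.

(** The sum over u now yields a second Gauss sum, which [gauss_sum_twist] pairs with the leftover
    one. What remains is a linear character sum over nonzero s, with frequency zero exactly when the
    hyperplane is tangent. *)
Lemma section_count_anisotropic_char m t c (v : vec F m.*2.+1) : sqnorm v != 0 ->
  #|sphere_section t c v|%:R * q ^+ 2 =
  q ^+ m.*2.+1 + ((quad_char (-1 : F))%:~R * q) ^+ m * (quad_char (sqnorm v))%:~R * q *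
    ((c ^+ 2 == t * sqnorm v)%:R * q - 1).
Proof.
move=> w0; set w := sqnorm v in w0 *.
have v0 : v != 0.
  apply: contraNneq w0 => v0.
  by rewrite /w v0 /sqnorm big1 // => i _; rewrite ffunE expr0n.
rewrite section_count_expand //; congr (_ + _).
have four0 : (4 : F) != 0 by rewrite (natrM F 2 2) mulf_neq0.
transitivity (\sum_(s | s != 0) ((quad_char (-1 : F))%:~R * q) ^+ m * (quad_char w)%:~R * q *
                psi ((c ^+ 2 / w - t) * s)).
  apply: eq_bigr => s s0; rewrite gauss_sum_odd_expr // -/w.
  have s'0 : - (w / (4 * s)) != 0.
    by rewrite oppr_eq0 mulf_neq0 ?invr_eq0 ?mulf_neq0.
  rewrite (sum_quadratic two_neq0 psi_char _ s'0).
  (* Up to a square factor the argument is [- (w * s)], the form that [gauss_sum_twist] requires. *)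
  have -> : - (w / (4 * s)) = - (w * s) * (2 * s)^-1 ^+ 2.
    by field; rewrite s0 two_neq0 four0.
  rewrite gauss_sum_square ?invr_eq0 ?mulf_neq0 //.
  have -> : (c ^+ 2 / w - t) * s =
     - (s * t) + - ((- c) ^+ 2 / (4 * (- (w * s) * (2 * s)^-1 ^+ 2))).
    by field; rewrite w0 s0 two_neq0 four0 oppr_eq0 mulf_neq0.
  rewrite psiD -[_ * _ * q]mulrA -(gauss_sum_twist two_neq0 psi_char s0 w0).
  by ring.
rewrite -mulr_sumr; congr (_ * _).
have -> : (c ^+ 2 == t * w) = (c ^+ 2 / w - t == 0).
  by rewrite subr_eq0 -[RHS](inj_eq (mulIf w0)) divfK.
by rewrite -(sum_additive_char psi_char) [in RHS](bigD1 0) //= mulr0 psi0 [RHS]addrC addKr.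
Qed.

End Counting.

(** * Integer point counts and bounds for sections *)

Section Sections.
Variables (F : finFieldType) (m : nat).
Hypothesis two_neq0 : (2 : F) != 0.
Local Notation q := (#|F|%:R : int).
Local Notation Q := (q ^+ m).
Implicit Types (t c : F) (v : vec F m.*2.+1).

Lemma q_gt0 : 0 < q.
Proof. by rewrite ltr0n; apply/card_gt0P; exists 0. Qed.

Let q_unit : q != 0. Proof. by rewrite gt_eqF ?q_gt0. Qed.

Let q_double : q ^+ m.*2.+1 = Q ^+ 2 * q.
Proof. by rewrite exprSr -muln2 exprM. Qed.

(* chi((-1)^m t) *)
Definition sphere_sign t : int := quad_char (-1 : F) ^+ m * quad_char t.

Lemma norm_sphere_sign t : `|sphere_sign t| <= 1.
Proof.
rewrite normrM normrX norm_quad_char ?oppr_eq0 ?oner_neq0 //.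
by rewrite expr1n mul1r norm_quad_char_le.
Qed.

Lemma card_sphere t : #|sphere m.*2.+1 t|%:R = Q ^+ 2 + sphere_sign t * Q.
Proof.
have [psi psi_char] := additive_char_exists F.
apply/(mulIf q_unit)/(intr_inj (R := algC)).
have := sphere_count_char two_neq0 psi_char m t.
rewrite /sphere_sign mulrDl -q_double !(rmorphM, rmorphD, rmorphXn, rmorph_nat) /= => ->.
by rewrite exprMn; ring.
Qed.

(** One factor [q] stays on the left, so that [Q ^+ 2] need not be divided by [q] among the
    integers. *)
Lemma card_section_isotropic t c v : v != 0 -> sqnorm v = 0 ->
  #|sphere_section t c v|%:R * q = Q ^+ 2 + (c == 0)%:R * sphere_sign t * Q * q.
Proof.
move=> v0 vv; have [psi psi_char] := additive_char_exists F.
apply/(mulIf q_unit)/(intr_inj (R := algC)).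
rewrite /sphere_sign mulrDl -q_double -[in LHS]mulrA -expr2.
have := section_count_isotropic_char two_neq0 psi_char t c v0 vv.
rewrite !(rmorphM, rmorphD, rmorphXn, rmorph_nat) /= => ->.
by rewrite exprMn; ring.
Qed.

Lemma card_section_anisotropic t c v : sqnorm v != 0 ->
  #|sphere_section t c v|%:R * q =
  Q ^+ 2 + sphere_sign (sqnorm v) * Q * ((c ^+ 2 == t * sqnorm v)%:R * q - 1).
Proof.
move=> w0; have [psi psi_char] := additive_char_exists F.
apply/(mulIf q_unit)/(intr_inj (R := algC)).
rewrite /sphere_sign mulrDl -q_double -[in LHS]mulrA -expr2.
have := section_count_anisotropic_char two_neq0 psi_char t c w0.
rewrite !(rmorphM, rmorphD, rmorphN, rmorph1, rmorphXn, rmorph_nat) /= => ->.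
by rewrite exprMn; ring.
Qed.

(** With no assumption on the sign, only the tangent case [c ^+ 2 = t * sqnorm v] can bring in a
    term of order [Q * q]. *)
Lemma card_section_le t c v : v != 0 ->
  #|sphere_section t c v|%:R * q <= Q ^+ 2 + Q + (c ^+ 2 == t * sqnorm v)%:R * Q * q.
Proof.
move=> v0; have Q0 : 0 < Q by rewrite exprn_gt0 ?q_gt0.
have Qq0 : 0 < Q * q by rewrite mulr_gt0 ?q_gt0.
have [vv|w0] := eqVneq (sqnorm v) 0.
  rewrite card_section_isotropic // vv mulr0 sqrf_eq0.
  have := norm_sphere_sign t; rewrite ler_norml => /andP[_].
  move: (sphere_sign t) (q ^+ m) Q0 Qq0 => e X X0 Xq0 e1.
  by case: (c == 0); rewrite ?mul1r ?mul0r; nra.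
rewrite card_section_anisotropic //.
have := norm_sphere_sign (sqnorm v); rewrite ler_norml => /andP[h1 h2].
have q1 : 1 < q by rewrite ltr1n finNzRing_gt1.
move: (sphere_sign _) (q ^+ m) Q0 Qq0 h1 h2 => e X X0 Xq0 h1 h2.
case: (_ == _); rewrite ?mul1r ?mul0r; last by nra.
suff: e * (X * (q - 1)) <= X * (q - 1) by lra.
by rewrite ger_pMl // mulr_gt0 // subr_gt0.
Qed.

(** Tangency to an anisotropic v puts t and [sqnorm v] in the same square class, so the term of
    order [Q * q] inherits the sign -1. For isotropic v that term already carries the sign of t. *)
Lemma card_section_le_sharp t c v : t != 0 -> sphere_sign t = -1 -> v != 0 ->
  #|sphere_section t c v|%:R * q <= Q ^+ 2 + Q.
Proof.
move=> t0 sgn_t v0; have Q0 : 0 < Q by rewrite exprn_gt0 ?q_gt0.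
have Qq0 : 0 < Q * q by rewrite mulr_gt0 ?q_gt0.
have [vv|w0] := eqVneq (sqnorm v) 0.
  by rewrite card_section_isotropic // sgn_t; case: (c == 0); rewrite ?mul1r ?mul0r; nra.
rewrite card_section_anisotropic //; have [ctw|_] := eqVneq.
  have -> : sphere_sign (sqnorm v) = -1.
    by rewrite -sgn_t /sphere_sign (quad_char_eq two_neq0 w0 t0 ctw).
  by rewrite mul1r; move: (q ^+ m) Q0 Qq0 => X X0 Xq0; nra.
have := norm_sphere_sign (sqnorm v); rewrite ler_norml => /andP[h1 h2].
by rewrite mul0r; move: (q ^+ m) (sphere_sign _) Q0 h1 => X e X0 h1; nra.
Qed.

End Sections.

(** * Cauchy-Schwarz, and distance conditions as sphere sections *)

Lemma sqr_sum_le (I : finType) (D : {set I}) (f : I -> int) :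
  (\sum_(i in D) f i) ^+ 2 <= #|D|%:R * \sum_(i in D) f i ^+ 2.
Proof.
(* Lagrange's identity: this double sum is twice the gap between the two sides. *)
have : 0 <= \sum_(i in D) \sum_(j in D) (f i - f j) ^+ 2.
  by apply: sumr_ge0 => i _; apply: sumr_ge0 => j _; apply: sqr_ge0.
suff -> : \sum_(i in D) \sum_(j in D) (f i - f j) ^+ 2 =
  2 * (#|D|%:R * \sum_(i in D) f i ^+ 2 - (\sum_(i in D) f i) ^+ 2) by lra.
transitivity (\sum_(i in D) (#|D|%:R * f i ^+ 2 + \sum_(j in D) f j ^+ 2
                             - 2 * f i * \sum_(j in D) f j)).
  apply: eq_bigr => i _; rewrite mulr_natl -sumr_const mulr_sumr -big_split /= -sumrB.
  by apply: eq_bigr => j _; ring.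
rewrite sumrB big_split /= -mulr_sumr -mulr_suml sumr_const -mulr_sumr -[_ *+ _]mulr_natl.
by ring.
Qed.

Lemma natr_card (I : finType) (D : {set I}) (P : pred I) :
  #|[set i in D | P i]|%:R = \sum_(i in D) (P i)%:R :> int.
Proof.
rewrite -sum1_card natr_sum big_mkcond [RHS]big_mkcond /=.
by apply: eq_bigr => i _; rewrite inE; case: (i \in D); case: (P i).
Qed.

Section Distances.
Variables (F : finFieldType) (d : nat).
Hypothesis two_neq0 : (2 : F) != 0.
Implicit Types (a b x y v : vec F d).

Lemma dist_expand a b : dist a b = sqnorm a - 2 * dot a b + sqnorm b.
Proof.
rewrite /dist /sqnorm /dot mulr_sumr -sumrB -big_split /=.
by apply: eq_bigr => i _; ring.
Qed.

Lemma dotB a x y : dot a (x - y) = dot a x - dot a y.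
Proof.
by rewrite /dot -sumrB; apply: eq_bigr => i _; rewrite !ffunE mulrBr.
Qed.

(** The term [sqnorm a] cancels between the two distances, leaving an equation linear in a. *)
Lemma equidistant_section j b b' :
  [set a in sphere d j | dist a b == dist a b'] =
  sphere_section j ((sqnorm b' - sqnorm b) / 2) (b' - b).
Proof.
apply/setP => a; rewrite !inE; congr (_ && _).
rewrite !dist_expand dotB -subr_eq0 -[RHS](inj_eq (mulfI two_neq0)) -[RHS]subr_eq0.
congr (_ == 0); by field.
Qed.

(** Translating a to the origin and subtracting the two sphere equations replaces one of the spheres
    by a hyperplane. *)
Lemma card_dist_pair a a' t t' :
  #|[set x | (dist a x == t) && (dist a' x == t')]| =
  #|sphere_section t ((t' - t - sqnorm (a - a')) / 2) (a - a')|.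
Proof.
rewrite -[RHS](card_imset _ (addrI a)); apply: eq_card => x.
have xE : x = a + (x - a) by rewrite addrC subrK.
rewrite [in RHS]xE (mem_imset _ _ (addrI a)) !inE.
have -> : \sum_(i < d) (x - a) i ^+ 2 = dist a x.
  by rewrite /dist; apply: eq_bigr => i _; rewrite !ffunE; ring.
case: eqP => //= <-.
have -> : dist a' x = dist a x + 2 * dot (x - a) (a - a') + sqnorm (a - a').
  rewrite /dist /sqnorm /dot mulr_sumr -!big_split /=.
  by apply: eq_bigr => i _; rewrite !ffunE; ring.
rewrite -[RHS](inj_eq (mulfI two_neq0)) -subr_eq0 -[RHS]subr_eq0.
by congr (_ == 0); field.
Qed.

End Distances.

(* al = |A|, be = |B|, ta = |Delta(A, B)|, p = q, X = q^m; K and L are the sums of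
   [shell_energy] over A and over the sphere. *)
Lemma many_centers_arith (al be ta p X K L : int) :
  0 < p -> 0 < X -> 0 <= be -> 0 <= ta -> X <= al -> 4 * ta < p ->
  4 * X ^+ 2 * p <= al * be ->
  al * be ^+ 2 <= ta * K ->
  p * K - al * be ^+ 2 <= p * L - (X ^+ 2 - X) * be ^+ 2 ->
  L * p <= be * (X ^+ 2 - X) * p + be ^+ 2 * (X ^+ 2 + X) -> False.
Proof.
move=> p0 X0 be0 ta0 hA hT h4 low up sph.
have pX2 : 0 < X ^+ 2 * p by rewrite mulr_gt0 ?exprn_gt0.
have pX : 0 < p * X by rewrite mulr_gt0.
have {be0} be_gt0 : 0 < be.
  rewrite lt_neqAle be0 andbT; apply/eqP => be_0.
  by move: h4; rewrite -be_0 mulr0 leNgt -mulrA mulr_gt0.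
have Xal : X * be <= al * be by rewrite ler_wpM2r // ltW.
have Xbe : 0 < X * be by rewrite mulr_gt0.
have X1 : X <= X ^+ 2 by rewrite expr2 ler_peMl ?(ltW X0) //; clear -X0; lia.
(* By [up] and [sph], [Z * be] bounds [p * K]. With [low] and [4 * ta < p] this gives
   [4 * (al * be) <= Z], while [X <= al] gives [Z <= 3 * (al * be) + p * (X ^+ 2 - X)], against
   [h4]. *)
pose Z := al * be + p * (X ^+ 2 - X) + 2 * X * be.
have Z0 : 0 <= Z.
  have : 0 <= p * (X ^+ 2 - X) by rewrite mulr_ge0 ?subr_ge0 // ltW.
  by rewrite /Z; clear -Xal Xbe; lra.
have pK : p * K <= Z * be by rewrite /Z; clear -up sph; lra.
have h1 : p * (al * be) <= ta * Z.
  rewrite -(ler_pM2r be_gt0) -!mulrA -expr2; apply: (@le_trans _ _ (ta * (p * K))).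
    by rewrite [leRHS]mulrCA ler_wpM2l // ltW.
  by rewrite ler_wpM2l.
have h2 : 4 * ta * Z <= p * Z by rewrite ler_wpM2r // ltW.
have : p * (4 * (al * be)) <= p * Z by clear -h1 h2; lra.
by rewrite ler_pM2l // /Z; clear -h4 pX2 Xal Xbe pX; lra.
Qed.

(** * The case of large A: variance of the shells around points of the sphere *)

Section SecondMoments.
Variables (F : finFieldType) (m : nat).
Hypothesis two_neq0 : (2 : F) != 0.
Local Notation d := m.*2.+1.
Local Notation q := (#|F|%:R : int).
Local Notation Q := (q ^+ m).
Variables (A B : {set vec F d}).
Local Notation T := (distset A B).
Implicit Types (a b x : vec F d).

Definition shell_energy a : int := \sum_t #|[set b in B | dist a b == t]|%:R ^+ 2.

Lemma shell_energyE a :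
  shell_energy a = \sum_(b in B) \sum_(b' in B) (dist a b == dist a b')%:R.
Proof.
transitivity (\sum_t \sum_(b in B) \sum_(b' in B) ((dist a b == t)%:R * (dist a b' == t)%:R : int)).
  apply: eq_bigr => t _; rewrite natr_card expr2 mulr_suml.
  by apply: eq_bigr => b _; rewrite mulr_sumr.
rewrite exchange_big; apply: eq_bigr => b _; rewrite exchange_big; apply: eq_bigr => b' _ /=.
rewrite (bigD1 (dist a b)) //= eqxx mul1r big1 ?addr0 1?eq_sym // => t.
by rewrite eq_sym => /negPf->; rewrite mul0r.
Qed.

Lemma sum_shells a (D : {set F}) : (forall b, b \in B -> dist a b \in D) ->
  \sum_(t in D) #|[set b in B | dist a b == t]|%:R = #|B|%:R :> int.
Proof.
move=> hD; under eq_bigr => t _ do rewrite natr_card.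
rewrite exchange_big -sum1_card natr_sum; apply: eq_bigr => b bB /=.
rewrite (bigD1 (dist a b)) ?hD //= eqxx big1 ?addr0 // => t /andP[_].
by rewrite eq_sym => /negPf->.
Qed.

(** Cauchy-Schwarz over the shells. It serves twice: with D the distance set as a lower bound for
    the energy, and with D all of F as nonnegativity of the variance. *)
Lemma shell_energy_ge a (D : {set F}) : (forall b, b \in B -> dist a b \in D) ->
  #|B|%:R ^+ 2 <= #|D|%:R * shell_energy a.
Proof.
move=> hD; rewrite -(sum_shells hD); apply: le_trans (sqr_sum_le _ _) _.
rewrite ler_wpM2l // /shell_energy [leRHS](bigID (mem D)) /= lerDl.
by apply: sumr_ge0 => t _; apply: sqr_ge0.
Qed.

(** Exchanging sums, each pair b, b' counts the points of the sphere equidistant from both: at most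
    the whole sphere if b = b', otherwise a section under the sharp bound. *)
Lemma shell_energy_sphere j : j != 0 -> sphere_sign m j = -1 ->
  (\sum_(a in sphere d j) shell_energy a) * q <=
  #|B|%:R * #|sphere d j|%:R * q + #|B|%:R ^+ 2 * (Q ^+ 2 + Q).
Proof.
move=> j0 sgn_j; have Q0 : 0 < Q by rewrite exprn_gt0 ?q_gt0.
have -> : \sum_(a in sphere d j) shell_energy a =
   \sum_(b in B) \sum_(b' in B) #|[set a in sphere d j | dist a b == dist a b']|%:R.
  under eq_bigr => a _ do rewrite shell_energyE.
  rewrite exchange_big; apply: eq_bigr => b _; rewrite exchange_big.
  by apply: eq_bigr => b' _ /=; rewrite natr_card.
rewrite mulr_suml; apply: (@le_trans _ _
   (\sum_(b in B) (#|sphere d j|%:R * q + #|B|%:R * (Q ^+ 2 + Q)))); last first.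
  by rewrite sumr_const -mulr_natl; lra.
apply: ler_sum => b bB; rewrite (bigD1 b) //= mulrDl mulr_suml.
apply: lerD.
  rewrite ler_wpM2r ?ler_nat ?(ltW (q_gt0 F)) // subset_leq_card //.
  by apply/subsetP => a; rewrite inE => /andP[].
apply: (@le_trans _ _ (\sum_(b' in B | b' != b) (Q ^+ 2 + Q))).
  apply: ler_sum => b' /andP[_ bb']; rewrite equidistant_section //.
  by apply: card_section_le_sharp => //; rewrite subr_eq0.
have -> : #|B|%:R * (Q ^+ 2 + Q) = \sum_(b' in B) (Q ^+ 2 + Q).
  by rewrite sumr_const mulr_natl.
rewrite [leRHS](bigD1 b) //= lerDr.
by rewrite addr_ge0 ?sqr_ge0 ?ltW.
Qed.

Lemma card_distset_many_centers j : A \subset sphere d j -> j != 0 -> sphere_sign m j = -1 ->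
  (4 * #|F| ^ d <= #|A| * #|B|)%N -> (#|F| ^ m <= #|A|)%N -> (#|F| <= 4 * #|T|)%N.
Proof.
move=> AS j0 sgn_j hAB hA; rewrite leqNgt; apply/negP => hT.
have Q0 : 0 < Q by rewrite exprn_gt0 ?q_gt0.
have q0 := q_gt0 F.
have dT a b : a \in A -> b \in B -> dist a b \in T by move=> aA bB; apply: imset2_f.
have low : #|A|%:R * #|B|%:R ^+ 2 <= #|T|%:R * \sum_(a in A) shell_energy a.
  rewrite mulr_natl -sumr_const mulr_sumr; apply: ler_sum => a aA.
  by apply: shell_energy_ge => b; apply: dT.
(* Each summand is a nonnegative variance (times q), so the sum may be extended from A to the whole
   sphere. *)
have up : \sum_(a in A) (q * shell_energy a - #|B|%:R ^+ 2) <=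
          \sum_(a in sphere d j) (q * shell_energy a - #|B|%:R ^+ 2).
  rewrite [leRHS](bigID (mem A)) /= [X in _ <= X + _](eq_bigl (mem A)) => [|a].
    rewrite lerDl sumr_ge0 // => a _; rewrite subr_ge0.
    by have := @shell_energy_ge a setT; rewrite cardsT; apply => b; rewrite inE.
  by have := subsetP AS a; rewrite /=; case: (a \in A) => [->|_] //=; rewrite andbF.
have := shell_energy_sphere j0 sgn_j; move: up.
rewrite !sumrB !sumr_const -!mulr_sumr -[_ *+ #|A|]mulr_natl -[_ *+ #|sphere d j|]mulr_natl.
rewrite (card_sphere m two_neq0) sgn_j mulN1r.
have : 4 * Q ^+ 2 * q <= #|A|%:R * #|B|%:R.
  by move: hAB; rewrite -(ler_nat int) !natrM natrX -mulrA -exprM muln2 -exprSr.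
move: hA hT; rewrite -(ler_nat int) -(ltr_nat int) natrM natrX.
move=> hA hT h4 up sph.
exact: (many_centers_arith q0 Q0 (ler0n _ _) (ler0n _ _) hA hT h4 low up sph).
Qed.

End SecondMoments.

(* Notation of [many_centers_arith]; M1 and M2 are the sums over x in F^d of N x and (N x)^2,
   with N x the number of a in A such that [dist a x] lies in Delta(A, B). *)
Lemma few_centers_arith (al be ta p X M1 M2 : int) :
  0 < p -> 0 < X -> 0 <= al -> 0 <= ta -> al <= X -> 4 * ta < p ->
  4 * X ^+ 2 * p <= al * be ->
  al * (ta * (X ^+ 2 - X)) <= M1 ->
  be * (al * (p - ta)) ^+ 2 <=
    p ^+ 2 * M2 - 2 * al * ta * p * M1 + X ^+ 2 * p * (al * ta) ^+ 2 ->
  M2 * p <= al * ta * (X ^+ 2 + X) * p +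
            al ^+ 2 * (ta ^+ 2 * (X ^+ 2 + X) + 2 * ta * X * p) -> False.
Proof.
move=> p0 X0 al0 ta0 hA hT h4 lowM1 low upM2.
have X1 : X <= X ^+ 2 by rewrite expr2 ler_peMl ?(ltW X0) //; clear -X0; lia.
have pX2 : 0 < X ^+ 2 * p by rewrite mulr_gt0 ?exprn_gt0.
have al_gt0 : 0 < al.
  rewrite lt_neqAle al0 andbT; apply/eqP => al_0.
  by move: h4; rewrite -al_0 mul0r leNgt -mulrA mulr_gt0.
have be_gt0 : 0 < be.
  by rewrite -(pmulr_rgt0 _ al_gt0); apply: lt_le_trans h4; rewrite -mulrA mulr_gt0.
set Y := X ^+ 2 + X.
(* Inserting the bounds on [M1] and [M2], the terms in [ta ^+ 2 * X ^+ 2] cancel and only [3 * X] is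
   left. *)
have bound : be * (al * (p - ta)) ^+ 2 <=
  p * (p * al * ta * Y) + al ^+ 2 * (3 * p * ta ^+ 2 * X + 2 * ta * p ^+ 2 * X).
  have e1 : p * (M2 * p) <= p * (al * ta * Y * p + al ^+ 2 * (ta ^+ 2 * Y + 2 * ta * X * p)).
    by rewrite ler_pM2l.
  have e2 : 2 * al * ta * p * (al * (ta * (X ^+ 2 - X))) <= 2 * al * ta * p * M1.
    by rewrite ler_wpM2l // !mulr_ge0 // ltW.
  by rewrite /Y in e1 *; clear -low e1 e2; lra.
have tap : ta <= p by clear -hT ta0; lra.
have pta : (3 * p) ^+ 2 <= (4 * (p - ta)) ^+ 2.
  by rewrite ler_sqr ?nnegrE ?mulr_ge0 ?subr_ge0 ?(ltW p0) //; clear -hT; lra.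
have step1 : be * al ^+ 2 * (3 * p) ^+ 2 <=
   16 * (p * (p * al * ta * Y) + al ^+ 2 * (3 * p * ta ^+ 2 * X + 2 * ta * p ^+ 2 * X)).
  apply: (@le_trans _ _ (be * al ^+ 2 * (4 * (p - ta)) ^+ 2)).
    by rewrite ler_wpM2l // mulr_ge0 ?exprn_ge0 // ltW.
  by clear -bound; lra.
have tap2 : 16 * ta ^+ 2 <= p ^+ 2.
  have : (4 * ta) ^+ 2 <= p ^+ 2 by rewrite ler_sqr ?nnegrE ?mulr_ge0 ?(ltW p0) // ltW.
  by clear; lra.
have Y0 : 0 <= Y by rewrite /Y addr_ge0 ?exprn_ge0 // ltW.
have f1 : p * (p * al * Y) * (4 * ta) <= p * (p * al * Y) * p.
  by rewrite ler_wpM2l ?(ltW hT) // !mulr_ge0 // ltW.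
have f2 : al ^+ 2 * (3 * p * X) * (16 * ta ^+ 2) <= al ^+ 2 * (3 * p * X) * p ^+ 2.
  by rewrite ler_wpM2l // !mulr_ge0 ?exprn_ge0 // ltW.
have f3 : al ^+ 2 * (p ^+ 2 * X) * (4 * ta) <= al ^+ 2 * (p ^+ 2 * X) * p.
  by rewrite ler_wpM2l ?(ltW hT) // !mulr_ge0 ?exprn_ge0 // ltW.
(* Replacing [4 * ta] by [p] in [step1] turns the coefficients 16, 48, 32 into 4, 3, 8, and 11 = 3 +
   8. *)
have g : (al * p ^+ 2) * (9 * (al * be)) <= (al * p ^+ 2) * (4 * (p * Y) + 11 * (al * (p * X))).
  by clear -step1 f1 f2 f3; lra.
move: g; rewrite ler_pM2l ?mulr_gt0 ?exprn_gt0 // => g.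
(* Now 9 [al * be] is at most (8 + 11) [p * X ^+ 2], whereas [h4] makes it at least 36
   [p * X ^+ 2]. *)
have g1 : al * (p * X) <= X * (p * X) by rewrite ler_wpM2r // mulr_ge0 // ltW.
have g2 : p * X <= p * X ^+ 2 by rewrite ler_wpM2l // ltW.
by rewrite /Y in g; clear -g g1 g2 h4 pX2; lra.
Qed.

(** * The case of small A: deviation of the number of hits over the whole space *)

Section FewCenters.
Variables (F : finFieldType) (m : nat).
Hypothesis two_neq0 : (2 : F) != 0.
Local Notation d := m.*2.+1.
Local Notation q := (#|F|%:R : int).
Local Notation Q := (q ^+ m).
Implicit Types (a b x : vec F d) (A B : {set vec F d}) (D : {set F}).

Lemma card_dist_sphere a t : #|[set x | dist a x == t]| = #|sphere d t|.
Proof.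
rewrite -[RHS](card_imset _ (addrI a)); apply: eq_card => x.
have xE : x = a + (x - a) by rewrite addrC subrK.
rewrite [in RHS]xE (mem_imset _ _ (addrI a)) !inE /dist; congr (_ == _).
by apply: eq_bigr => i _; rewrite !ffunE; ring.
Qed.

Lemma in_natrE D t : (t \in D)%:R = \sum_(u in D) (t == u)%:R :> int.
Proof.
have [tD|tD] := boolP (t \in D).
  by rewrite (bigD1 t) //= eqxx big1 ?addr0 // => u /andP[_]; rewrite eq_sym => /negPf->.
by rewrite big1 // => u uD; case: eqP tD => // ->; rewrite uD.
Qed.

Lemma natr_cardT (I : finType) (P : pred I) :
  #|[set i | P i]|%:R = \sum_i (P i)%:R :> int.
Proof.
rewrite -sum1_card natr_sum big_mkcond /=.
by apply: eq_bigr => i _; rewrite inE; case: (P i).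
Qed.

Lemma sum_hits a D :
  \sum_x (dist a x \in D)%:R = \sum_(t in D) #|sphere d t|%:R :> int.
Proof.
under eq_bigr => x _ do rewrite in_natrE.
by rewrite exchange_big; apply: eq_bigr => t _ /=; rewrite -natr_cardT card_dist_sphere.
Qed.

Lemma sum_hits_le a D : \sum_x (dist a x \in D)%:R <= #|D|%:R * (Q ^+ 2 + Q).
Proof.
rewrite sum_hits mulr_natl -sumr_const; apply: ler_sum => t _.
rewrite (card_sphere m two_neq0) lerD2l ger_pMl ?exprn_gt0 ?q_gt0 //.
by have := norm_sphere_sign m two_neq0 t; rewrite ler_norml => /andP[].
Qed.

Lemma sum_hits_ge a D : #|D|%:R * (Q ^+ 2 - Q) <= \sum_x (dist a x \in D)%:R.
Proof.
rewrite sum_hits mulr_natl -sumr_const; apply: ler_sum => t _.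
rewrite (card_sphere m two_neq0) lerD2l -mulN1r ler_pM2r ?exprn_gt0 ?q_gt0 //.
by have := norm_sphere_sign m two_neq0 t; rewrite ler_norml => /andP[].
Qed.

(** For fixed t the map from t' to (t' - t - w)/2 is injective, so the solutions inject into the
    square roots of t w. *)
Lemma card_tangent_le D t w :
  \sum_(t' in D) (((t' - t - w) / 2) ^+ 2 == t * w)%:R <= 2 :> int.
Proof.
rewrite -natr_card; apply: (@le_trans _ _ (nb_sqrt (t * w))%:R); last first.
  by rewrite (ler_nat _ _ 2) nb_sqrt_le2.
rewrite ler_nat /nb_sqrt -(card_imset _ (f := fun t' => (t' - t - w) / 2)) => [|x y].
  by apply/subset_leq_card/subsetP => _ /imsetP[t' + ->]; rewrite !inE => /andP[].
by move/(mulIf (invr_neq0 two_neq0))/addIr/addIr.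
Qed.

(** The points counted lie on intersections of two spheres, that is, on sphere sections. For each t
    at most two t' give a tangent section, whence the term with factor 2. *)
Lemma pair_hits_le a a' D : a != a' ->
  (\sum_x (dist a x \in D)%:R * (dist a' x \in D)%:R) * q <=
  #|D|%:R ^+ 2 * (Q ^+ 2 + Q) + 2 * #|D|%:R * Q * q.
Proof.
move=> aa'; have Qq0 : 0 <= Q * q by rewrite mulr_ge0 ?exprn_ge0 ?ler0n.
have -> : \sum_x (dist a x \in D)%:R * (dist a' x \in D)%:R =
  \sum_(t in D) \sum_(t' in D)
     #|sphere_section t ((t' - t - sqnorm (a - a')) / 2) (a - a')|%:R :> int.
  under eq_bigr => x _ do rewrite !in_natrE mulr_suml.
  rewrite exchange_big; apply: eq_bigr => t _ /=.
  under eq_bigr => x _ do rewrite mulr_sumr.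
  rewrite exchange_big; apply: eq_bigr => t' _ /=.
  rewrite -card_dist_pair // natr_cardT; apply: eq_bigr => x _.
  by case: (_ == _); case: (_ == _).
rewrite mulr_suml; apply: (@le_trans _ _
   (\sum_(t in D) (#|D|%:R * (Q ^+ 2 + Q) + 2 * (Q * q)))); last first.
  by rewrite sumr_const -mulr_natl; lra.
apply: ler_sum => t _; rewrite mulr_suml.
set w := sqnorm (a - a').
apply: (@le_trans _ _ (\sum_(t' in D)
   (Q ^+ 2 + Q + (((t' - t - w) / 2) ^+ 2 == t * w)%:R * Q * q))).
  by apply: ler_sum => t' _; apply: card_section_le; rewrite ?subr_eq0.
under eq_bigr => t' _ do rewrite -mulrA.
rewrite big_split -mulr_suml; apply: lerD; last by rewrite ler_wpM2r ?card_tangent_le.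
by rewrite sumr_const mulr_natl.
Qed.

Lemma sum_hits_sqr_le A D :
  (\sum_x (\sum_(a in A) (dist a x \in D)%:R) ^+ 2) * q <=
  #|A|%:R * #|D|%:R * (Q ^+ 2 + Q) * q +
  #|A|%:R ^+ 2 * (#|D|%:R ^+ 2 * (Q ^+ 2 + Q) + 2 * #|D|%:R * Q * q).
Proof.
set V := (X in _ ^+ 2 * X).
have V0 : 0 <= V.
  by rewrite /V !addr_ge0 ?mulr_ge0 ?addr_ge0 ?exprn_ge0 ?exprn_ge0 ?ler0n.
have -> : \sum_x (\sum_(a in A) (dist a x \in D)%:R) ^+ 2 =
  \sum_(a in A) \sum_(a' in A) \sum_x (dist a x \in D)%:R * (dist a' x \in D)%:R :> int.
  under eq_bigr => x _ do rewrite expr2 mulr_suml.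
  rewrite exchange_big; apply: eq_bigr => a _ /=.
  under eq_bigr => x _ do rewrite mulr_sumr.
  by rewrite exchange_big.
rewrite mulr_suml; apply: (@le_trans _ _
   (\sum_(a in A) (#|D|%:R * (Q ^+ 2 + Q) * q + #|A|%:R * V))); last first.
  by rewrite sumr_const -mulr_natl; lra.
apply: ler_sum => a aA; rewrite (bigD1 a) //= mulrDl [X in _ + X <= _]mulr_suml; apply: lerD.
  rewrite ler_wpM2r ?ler0n //; apply: le_trans (sum_hits_le a D).
  by apply: ler_sum => x _; case: (_ \in _).
apply: (@le_trans _ _ (\sum_(a' in A | a' != a) V)).
  by apply: ler_sum => a' /andP[_ aa']; apply: pair_hits_le; rewrite eq_sym.
have -> : #|A|%:R * V = \sum_(a' in A) V by rewrite sumr_const mulr_natl.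
by rewrite [leRHS](bigD1 a) //= lerDr.
Qed.

Lemma card_distset_few_centers A B :
  (4 * #|F| ^ d <= #|A| * #|B|)%N -> (#|A| <= #|F| ^ m)%N -> (#|F| <= 4 * #|distset A B|)%N.
Proof.
move=> hAB hA; rewrite leqNgt; apply/negP => hT; set T := distset A B in hT *.
have Q0 : 0 < Q by rewrite exprn_gt0 ?q_gt0.
have q0 := q_gt0 F.
have := sum_hits_sqr_le A T.
pose N x : int := \sum_(a in A) (dist a x \in T)%:R; rewrite -/(N _).
have sumN : #|A|%:R * (#|T|%:R * (Q ^+ 2 - Q)) <= \sum_x N x.
  rewrite exchange_big mulr_natl -sumr_const; apply: ler_sum => a _.
  exact: sum_hits_ge.
(* Every b in B is hit by all of A, so [N b] is the size of A; the points outside B only add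
   squares. *)
have : #|B|%:R * (#|A|%:R * (q - #|T|%:R)) ^+ 2 <= \sum_x (q * N x - #|A|%:R * #|T|%:R) ^+ 2.
  rewrite mulr_natl -sumr_const [leRHS](bigID (mem B)) /=.
  rewrite -[leLHS]addr0 lerD ?sumr_ge0 // => [|x _]; last exact: sqr_ge0.
  apply: ler_sum => b bB; rewrite /N (eq_bigr (fun=> 1)) => [|a aA].
    by rewrite sumr_const mulrBr mulrC.
  by rewrite imset2_f.
have -> : \sum_x (q * N x - #|A|%:R * #|T|%:R) ^+ 2 =
   q ^+ 2 * (\sum_x N x ^+ 2) - 2 * #|A|%:R * #|T|%:R * q * (\sum_x N x)
   + Q ^+ 2 * q * (#|A|%:R * #|T|%:R) ^+ 2.
  have -> : Q ^+ 2 * q * (#|A|%:R * #|T|%:R) ^+ 2 = \sum_(x : vec F d) (#|A|%:R * #|T|%:R) ^+ 2.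
    have -> : Q ^+ 2 * q = q ^+ d by rewrite [RHS]exprSr -muln2 exprM.
    by rewrite sumr_const card_ffun card_ord -[RHS]mulr_natl natrX.
  rewrite !mulr_sumr -sumrB -big_split /=.
  by apply: eq_bigr => x _; ring.
have : 4 * Q ^+ 2 * q <= #|A|%:R * #|B|%:R.
  by move: hAB; rewrite -(ler_nat int) !natrM natrX -mulrA -exprM muln2 -exprSr.
move: hA hT; rewrite -(ler_nat int) -(ltr_nat int) natrM natrX.
move=> hA hT h4 low upM2.
exact: (few_centers_arith q0 Q0 (ler0n _ _) (ler0n _ _) hA hT h4 sumN low upM2).
Qed.

End FewCenters.

(** * The arithmetic hypotheses as a sign condition, and the conclusion *)

Lemma sphere_sign_eqN1 (F : finFieldType) (d : nat) (j : F) :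
  (2 : F) != 0 -> j != 0 ->
  ((is_square j /\ (exists k : nat, (0 < k)%N /\ d = (4 * k - 1)%N)
        /\ (#|F| %% 4 = 3)%N)
      \/
      (~ is_square j /\
        ((exists k : nat, (0 < k)%N /\ d = (4 * k + 1)%N) \/
         ((exists k : nat, (0 < k)%N /\ d = (4 * k - 1)%N) /\ (#|F| %% 4 = 1)%N)))) ->
  exists2 m, d = m.*2.+1 & sphere_sign m j = -1.
Proof.
move=> two0 j0.
have N1_0 : (-1 : F) != 0 by rewrite oppr_eq0 oner_neq0.
have sqrN1 k : quad_char (-1 : F) ^+ (k * 2) = 1.
  by rewrite mulnC exprM -real_normK ?num_real // norm_quad_char // !expr1n.
case=> [[sq_j [[k [k_gt0 ->]] q3]]|[nsq_j h]].
  (* For d = 4k-1 the index m is 2k-1, which is odd, so m keeps the sign of chi(-1); for d = 4k+1 it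
     is 2k and that sign drops out. *)
  exists (k.-1.*2.+1); first by lia.
  rewrite /sphere_sign (quad_char_square two0 j0 sq_j) quad_charN1_3mod4 //.
  by rewrite mulr1 -signr_odd /= odd_double.
rewrite /sphere_sign (quad_char_nonsquare nsq_j); case: h => [[k [_ ->]]|[[k [k_gt0 ->]] q1]].
  by exists (k * 2)%N; [lia|rewrite sqrN1 mul1r].
exists (k.-1.*2.+1); first by lia.
by rewrite quad_charN1_1mod4 // expr1n mul1r.
Qed.

Theorem theorem1p19 (F : finFieldType) (d : nat) (j : F)
    (A B : {set vec F d}) :
    ~~ (2 \in [pchar F]) -> j != 0 -> A \subset sphere d j ->
    (((is_square j /\ (exists k : nat, (0 < k)%N /\ d = (4 * k - 1)%N)
        /\ (#|F| %% 4 = 3)%N)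
      \/
      (~ is_square j /\
        ((exists k : nat, (0 < k)%N /\ d = (4 * k + 1)%N) \/
         ((exists k : nat, (0 < k)%N /\ d = (4 * k - 1)%N) /\ (#|F| %% 4 = 1)%N))))
     /\ (4 * #|F| ^ d <= #|A| * #|B|)%N) ->
    (#|F| <= 4 * #|distset A B|)%N.
Proof.
rewrite inE => /= two0 j0 AS [hyp].
have [m dE sgn_j] := sphere_sign_eqN1 two0 j0 hyp.
rewrite {}dE in A B AS *; have [leA|/ltnW leA] := leqP (#|F| ^ m)%N #|A|.
  by move=> hAB; apply: (card_distset_many_centers two0 AS j0 sgn_j).
by move=> hAB; apply: (card_distset_few_centers two0 hAB leA).
Qed.
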